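(* Let $f:\mathcal{X}\to\mathbb{R}$ be differentiable, geodesically $L$-smooth and geodesically $\mu$-strongly convex ($0<\mu\le L$), with minimizer $x^*\in\mathcal{X}$. Let $\{y_k\}_{k\ge0}$ and $\{v_k\}_{k\ge0}$ be sequences in $\mathcal{X}$ with $v_0=y_0$, and let $\{\gamma_k\}_{k\ge 0}$, $\{\overline{\gamma}_k\}_{k\ge1}$, $\{\Phi_k^*\}_{k\ge0}$, $\{\alpha_k\}_{k\ge0}$ be real sequences with $\gamma_k>0$. Let $\Phi_0(x)=\Phi_0^*+\frac{\gamma_0}{2}\|\mathrm{Exp}_{y_0}^{-1}(x)\|^2$. Assume that for all $k\ge0$: $$\overline{\gamma}_{k+1}=(1-\alpha_k)\gamma_k+\alpha_k\mu,$$ $$v_{k+1}=\mathrm{Exp}_{y_k}\!\left(\frac{(1-\alpha_k)\gamma_k}{\overline{\gamma}_{k+1}}\mathrm{Exp}_{y_k}^{-1}(v_k)-\frac{\alpha_k}{\overline{\gamma}_{k+1}}\mathrm{grad} f(y_k)\right),$$ $$\Phi_{k+1}^*=(1-\alpha_k)\Phi_k^*+\alpha_kf(y_k)-\frac{\alpha_k^2}{2\overline{\gamma}_{k+1}}\|\mathrm{grad} f(y_k)\|^2+\frac{\alpha_k(1-\alpha_k)\gamma_k}{\overline{\gamma}_{k+1}}\left(\frac{\mu}{2}\|\mathrm{Exp}_{y_k}^{-1}(v_k)\|^2+\langle\mathrm{grad} f(y_k),\mathrm{Exp}_{y_k}^{-1}(v_k)\rangle\right),$$ $$\gamma_{k+1}\|\mathrm{Exp}_{y_{k+1}}^{-1}(x^*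 )-\mathrm{Exp}_{y_{k+1}}^{-1}(v_{k+1})\|^2\le\overline{\gamma}_{k+1}\|\mathrm{Exp}_{y_k}^{-1}(x^* )-\mathrm{Exp}_{y_k}^{-1}(v_{k+1})\|^2,$$ and $\alpha_k\in(0,1)$, $\sum_{k=0}^\infty\alpha_k=\infty$. Then the pair of sequences $\{\Phi_k\}_{k\ge0}$, $\{\lambda_k\}_{k\ge0}$ defined by $\Phi_0(x)=\Phi_0^*+\frac{\gamma_0}{2}\|\mathrm{Exp}_{y_0}^{-1}(x)\|^2$ and $$\Phi_{k+1}(x)=\Phi_{k+1}^*+\frac{\gamma_{k+1}}{2}\|\mathrm{Exp}_{y_{k+1}}^{-1}(x)-\mathrm{Exp}_{y_{k+1}}^{-1}(v_{k+1})\|^2\quad(k\ge 0),\qquad \lambda_0=1,\ \lambda_{k+1}=(1-\alpha_k)\lambda_k,$$ is a (weak) estimate sequence of $f$.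
   Context: Geometry. $(\mathcal{M},\mathfrak{g})$ is a Riemannian manifold with geodesic distance $d$; $\langle\cdot,\cdot\rangle$ and $\|\cdot\|$ are the inner product and norm on tangent spaces; $\mathrm{Exp}_x$ is the exponential map at $x$. $\mathcal{X}\subset\mathcal{M}$ is geodesically convex (any two of its points are joined by a geodesic contained in $\mathcal{X}$) and the exponential map and its inverse are well defined on $\mathcal{X}$: between any two points $x,y\in\mathcal{X}$ there is a unique geodesic, $\mathrm{Exp}_x^{-1}(y)\in T_x\mathcal{M}$ is its initial velocity (for the parametrization on $[0,1]$), and $\|\mathrm{Exp}_x^{-1}(y)\|=\|\mathrm{Exp}_y^{-1}(x)\|=d(x,y)$. For the points defined by $v_{k+1}=\mathrm{Exp}_{y_k}(w)\in\mathcal{X}$ it is understood that $\mathrm{Exp}_{y_k}^{-1}(v_{k+1})=w$. Function classes. $\mathrm{grad} f$ is the Riemannian gradient. $f$ is geodesically $\mu$-strongly convex if for all $x,y\in\mathcal{X}$, $f(y)\ge f(x)+\langle\mathrm{grad} f(x),\mathrm{Exp}_x^{-1}(y)\rangle+\frac{\mu}{2}\|\mathrm{Exp}_x^{-1}(y)\|^2$. $f$ is geodesically $L$-smooth if $\|\mathrm{grad} f(x)-\Gamma_y^x\,\mathrm{grad} f(y)\|\le L\|\mathrm{Exp}_x^{-1}(y)\|$ for all $x,y\in\mathcal{X}$, where $\Gamma_y^x$ is parallel transport from $y$ to $x$ along the geodesic. (Weak) estimate sequence. A pair of sequences $\{\Phi_k:\mathcal{X}\to\mathbb{R}\}_{k\ge0}$,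 $\{\lambda_k\}_{k\ge0}$ is a (weak) estimate sequence of $f$ if $\lambda_k\to0$ and for all $k\ge0$, $\Phi_k(x^* )\le(1-\lambda_k)f(x^* )+\lambda_k\Phi_0(x^* )$, where $x^*$ is the minimizer of $f$. *)

(* Defs.v *)
From mathcomp Require Import all_boot all_order all_algebra.
From mathcomp Require Import all_classical all_reals all_analysis.

Set Implicit Arguments.
Unset Strict Implicit.
Unset Printing Implicit Defensive.

Import Order.TTheory GRing.Theory Num.Theory numFieldNormedType.Exports.

Local Open Scope classical_set_scope.
Local Open Scope ring_scope.

(* C^k and C^oo maps on an open set U. *)
Fixpoint Ck_on (R : realType) (V W : normedModType R) (k : nat)
    (U : set V) (f : V -> W) : Prop :=
  match k with
  | 0 => forall u, U u -> {for u, continuous f}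
  | k'.+1 => (forall u, U u -> differentiable f u) /\
             (forall v, Ck_on k' U (fun u => 'D_v f u))
  end.

Definition smooth_on (R : realType) (V W : normedModType R)
    (U : set V) (f : V -> W) : Prop := forall k, Ck_on k U f.

(* Smooth n-manifolds without boundary.  The atlas is indexed by [atlas];
   chart i is the homeomorphism [coord i] from the open set [dom i] onto an open
   subset of R^n, with inverse [param i] (junk outside that open subset).
   [chart_at p] is a chosen chart around p. *)
Record smooth_manifold (R : realType) (n : nat) := SmoothManifold {
  point :> topologicalType;
  point_hausdorff : hausdorff_space point;
  point_second_countable : @second_countable point;
  atlas : Type;
  dom : atlas -> set point;
  coord : atlas -> point -> 'rV[R]_n;
  param : atlas -> 'rV[R]_n -> point;
  chart_at : point -> atlas;
  chart_atP : forall p, dom (chart_at p) p;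
  dom_open : forall i, open (dom i);
  coord_open : forall i, open (coord i @` dom i);
  coordK : forall i p, dom i p -> param i (coord i p) = p;
  coord_continuous : forall i p, dom i p -> {for p, continuous (coord i)};
  param_continuous : forall i u, (coord i @` dom i) u ->
    {for u, continuous (param i)};
  transition_smooth : forall i j,
    smooth_on (coord i @` (dom i `&` dom j)) (coord j \o param i)
}.

Section Tangent.
Variables (R : realType) (n : nat) (M : smooth_manifold R n).

(* The tangent space T_p M is 'rV[R]_n: a tangent vector at p is given by its
   components in the chart [chart_at p].  [tangent_change i j p] converts
   components in chart i into components in chart j, for p in both domains. *)
Definition tangent_change (i j : atlas M) (p : M) (w : 'rV[R]_n) : 'rV[R]_n :=
  'D_w (@coord R n M j \o @param R n M i) (coord i p).

Definition to_chart (i : atlas M) (p : M) (w : 'rV[R]_n) : 'rV[R]_n :=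
  tangent_change (chart_at p) i p w.

Definition from_chart (i : atlas M) (p : M) (w : 'rV[R]_n) : 'rV[R]_n :=
  tangent_change i (chart_at p) p w.

Definition unit_vec (a : 'I_n) : 'rV[R]_n := delta_mx 0 a.

(* Components g_ab in chart i, at the point of coordinates u, of the bilinear
   forms given on each T_p M by the matrix [gram p]. *)
Definition metric_coef (gram : M -> 'M[R]_n) (i : atlas M) (u : 'rV[R]_n)
    : 'M[R]_n :=
  let p := param i u in
  \matrix_(a, b)
    (from_chart i p (unit_vec a) *m gram p *m (from_chart i p (unit_vec b))^T) 0 0.

(* The velocity at time t of a curve c, an element of T_(c t) M. *)
Definition velocity (c : R -> M) (t : R) : 'rV[R]_n :=
  derive1 (@coord R n M (chart_at (c t)) \o c) t.

End Tangent.

Record riemannian_manifold (R : realType) (n : nat) := RiemannianManifold {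
  manifold :> smooth_manifold R n;
  gram : manifold -> 'M[R]_n;
  gram_sym : forall p, (gram p)^T = gram p;
  gram_pos : forall p (w : 'rV[R]_n), w != 0 -> 0 < (w *m gram p *m w^T) 0 0;
  gram_smooth : forall (i : atlas manifold) (a b : 'I_n),
    smooth_on (coord i @` dom i)
      (fun u : 'rV[R]_n => metric_coef gram i u a b : R)
}.

Section Riemannian.
Variables (R : realType) (n : nat) (M : riemannian_manifold R n).

Definition inner (p : M) (v w : 'rV[R]_n) : R := (v *m gram p *m w^T) 0 0.

Definition tnorm (p : M) (w : 'rV[R]_n) : R := Num.sqrt (inner p w w).

(* Gamma^k_ab = 1/2 g^kl (d_a g_bl + d_b g_al - d_l g_ab), in chart i. *)
Definition christoffel (i : atlas M) (u : 'rV[R]_n) (a b k : 'I_n) : R :=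
  let g := metric_coef (@gram R n M) i in
  let d (c a' b' : 'I_n) : R := 'D_(unit_vec R c) (fun u' => g u' a' b' : R) u in
  2^-1 * \sum_(l < n) invmx (g u) k l * (d a b l + d b a l - d l a b).

(* The vector field V (with V t in T_(c t) M) is parallel along the curve c on
   the open set of times D for the Levi-Civita connection: in every chart,
   (V^k)' + Gamma^k_ab (c^a)' V^b = 0. *)
Definition parallel_along (D : set R) (c : R -> M) (V : R -> 'rV[R]_n) : Prop :=
  forall t, D t -> {for t, continuous c} /\
  forall i : atlas M, dom i (c t) ->
    let x := coord i \o c in
    let xi := fun s => to_chart i (c s) (V s) in
    derivable x t 1 /\ derivable xi t 1 /\
    forall k, derive1 xi t 0 k +
      \sum_(a < n) \sum_(b < n)
        christoffel i (x t) a b k * derive1 x t 0 a * xi t 0 b = 0.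

Definition geodesic_on (D : set R) (c : R -> M) : Prop :=
  parallel_along D c (velocity c).

Definition around01 (P : set R -> Prop) : Prop :=
  exists2 e : R, 0 < e & P `](- e), (1 + e)[%classic.

(* A geodesic from x to y parametrized on [0, 1] and contained in X; only the
   values on [0, 1] matter. *)
Definition geodesic_segment (X : set M) (x y : M) (c : R -> M) : Prop :=
  [/\ around01 (fun D => geodesic_on D c), c 0 = x, c 1 = y &
      forall t, t \in `[0, 1] -> X (c t)].

Definition is_Exp (x : M) (w : 'rV[R]_n) (y : M) : Prop :=
  exists c : R -> M, [/\ around01 (fun D => geodesic_on D c),
    c 0 = x, velocity c 0 = w & c 1 = y].

(* M need not be complete: [Exp_dom x] is the set of w such that Exp_x(w) is
   defined; outside of it [Exp x w] is a dummy value. *)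
Definition Exp_dom (x : M) (w : 'rV[R]_n) : Prop := exists y, is_Exp x w y.

Definition Exp (x : M) (w : 'rV[R]_n) : M := xget x [set y | is_Exp x w y].

(* Exp_x^-1(y): the initial velocity of the geodesic from x to y inside X, for
   x, y in a set X as in [uniquely_geodesic] below. *)
Definition Log (X : set M) (x y : M) : 'rV[R]_n :=
  xget 0 [set w | exists2 c, geodesic_segment X x y c & velocity c 0 = w].

(* Parallel transport of w from x to y along the geodesic of X joining them. *)
Definition transport (X : set M) (x y : M) (w : 'rV[R]_n) : 'rV[R]_n :=
  xget 0 [set w' | exists c V, [/\ geodesic_segment X x y c,
    around01 (fun D => parallel_along D c V), V 0 = w & V 1 = w']].

Definition C1_on (D : set R) (c : R -> M) : Prop :=
  forall t, D t -> {for t, continuous c} /\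
  forall i : atlas M, dom i (c t) ->
    derivable (coord i \o c) t 1 /\ {for t, continuous (derive1 (coord i \o c))}.

Definition curve_length (c : R -> M) : \bar R :=
  (\int[lebesgue_measure]_(t in `[0%R, 1%R]) (tnorm (c t) (velocity c t))%:E)%E.

(* l is the length of a piecewise C^1 curve from x to y, given as a finite chain
   of C^1 curves, each parametrized on [0, 1]. *)
Inductive joined_with_length : M -> M -> \bar R -> Prop :=
| joined_nil x : joined_with_length x x 0%E
| joined_cons (c : R -> M) y l :
    around01 (fun D => C1_on D c) -> joined_with_length (c 1) y l ->
    joined_with_length (c 0) y (curve_length c + l)%E.

Definition dist (x y : M) : \bar R := ereal_inf [set l | joined_with_length x y l].

(* X is geodesically convex, with a unique geodesic inside X between any two of
   its points, and the norm of its initial velocity is the distance. *)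
Definition uniquely_geodesic (X : set M) : Prop :=
  (forall x y, X x -> X y ->
     exists2 c, geodesic_segment X x y c &
       forall c', geodesic_segment X x y c' ->
         forall t, t \in `[0, 1] -> c' t = c t) /\
  (forall x y, X x -> X y ->
     (tnorm x (Log X x y))%:E = dist x y /\
     (tnorm y (Log X y x))%:E = dist x y).

(* f is differentiable on X with Riemannian gradient gradf: with phi the chart
   at x, f z = f x + <gradf x, phi z - phi x>_x + o(|phi z - phi x|) as z tends
   to x in X.  Only the values of f on X matter, and X need not be open. *)
Definition is_gradient (X : set M) (f : M -> R) (gradf : M -> 'rV[R]_n) : Prop :=
  forall x, X x ->
    let phi := coord (chart_at x) in
    (fun z => (f z - f x - inner x (gradf x) (phi z - phi x))
              / `|phi z - phi x|) @ within X (nbhs x) --> (0 : R).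

Definition geodesically_strongly_convex (X : set M) (f : M -> R)
    (gradf : M -> 'rV[R]_n) (mu : R) : Prop :=
  forall x y, X x -> X y ->
    f x + inner x (gradf x) (Log X x y) + mu / 2 * tnorm x (Log X x y) ^+ 2
    <= f y.

Definition geodesically_smooth (X : set M) (gradf : M -> 'rV[R]_n) (L : R) : Prop :=
  forall x y, X x -> X y ->
    tnorm x (gradf x - transport X y x (gradf y)) <= L * tnorm x (Log X x y).

Definition is_minimizer (X : set M) (f : M -> R) (xs : M) : Prop :=
  X xs /\ forall x, X x -> f xs <= f x.

(* (Weak) estimate sequence of f, whose minimizer is xs. *)
Definition weak_estimate_sequence (f : M -> R) (xs : M)
    (Phi : nat -> M -> R) (lambda : nat -> R) : Prop :=
  lambda k @[k --> \oo] --> (0 : R) /\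
  forall k, Phi k xs <= (1 - lambda k) * f xs + lambda k * Phi 0%N xs.

End Riemannian.

(* Main.v *)
(** In the tangent space at [y k], with [V = Log (y k) (v k)], the function [x |-> (1 - alpha k) (Phis k +
    gamma k / 2 |x - V|^2) + alpha k (f + <g, x> + mu / 2 |x|^2)] is a quadratic
    with leading coefficient [gbar k.+1 / 2], whose completed square is centred at
    [Log (y k) (v k.+1)] and has minimum value [Phis k.+1].  At [x = Log (y k) xs]
    strong convexity bounds the second summand by [alpha k * f xs], and the
    distortion hypothesis moves the square from [y k] to [y k.+1].  Hence
    [Phi k xs - f xs] contracts by [1 - alpha k] at each step.  Moreover
    [lambda k * (1 + \sum_(i < k) alpha i)] is nonincreasing, so [lambda]
    vanishes when the sum of the steps diverges. *)
Require Import Defs.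
From mathcomp Require Import all_boot all_order all_algebra.
From mathcomp Require Import all_classical all_reals all_analysis.
From mathcomp Require Import ring lra.
Import Order.TTheory GRing.Theory Num.Theory numFieldNormedType.Exports.
Local Open Scope classical_set_scope.
Local Open Scope ring_scope.

Section Inner.
Context {R : realType} {n : nat} {M : riemannian_manifold R n}.
Implicit Types (p : M) (a : R) (u v w : 'rV[R]_n).

Lemma innerC p u v : inner p u v = inner p v u.
Proof.
rewrite /inner -(trmxK (u *m gram p *m v^T)) [LHS]mxE.
by rewrite !trmx_mul trmxK gram_sym mulmxA.
Qed.

Lemma innerDl p u v w : inner p (u + v) w = inner p u w + inner p v w.
Proof. by rewrite /inner !mulmxDl mxE. Qed.

Lemma innerZl p a u v : inner p (a *: u) v = a * inner p u v.
Proof. by rewrite /inner -!scalemxAl mxE. Qed.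

Lemma innerNl p u v : inner p (- u) v = - inner p u v.
Proof. by rewrite -scaleN1r innerZl mulN1r. Qed.

Lemma innerDr p u v w : inner p u (v + w) = inner p u v + inner p u w.
Proof. by rewrite innerC innerDl !(innerC p u). Qed.

Lemma innerZr p a u v : inner p u (a *: v) = a * inner p u v.
Proof. by rewrite innerC innerZl (innerC p u). Qed.

Lemma innerNr p u v : inner p u (- v) = - inner p u v.
Proof. by rewrite innerC innerNl (innerC p u). Qed.

Definition innerE := (innerDl, innerDr, innerNl, innerNr, innerZl, innerZr).

Lemma sqr_tnorm p u : tnorm p u ^+ 2 = inner p u u.
Proof.
(* Squaring undoes [Num.sqrt] only on nonnegative reals, and [gram_pos] covers only nonzero
   vectors. *)
rewrite /tnorm sqr_sqrtr //; have [->|u0] := eqVneq u 0.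
  by rewrite /inner mul0mx mul0mx mxE.
exact/ltW/gram_pos.
Qed.

Lemma tnorm_eq0 p u : tnorm p u = 0 -> u = 0.
Proof.
move=> u0; apply/eqP; apply: contraT => /(gram_pos p).
by rewrite -/(inner p u u) -sqr_tnorm u0 expr0n ltxx.
Qed.

(** The empty chain of curves bounds the distance from [p] to itself by 0. *)
Lemma Log_refl (X : set M) p : uniquely_geodesic X -> X p -> Log X p p = 0.
Proof.
move=> [_ distE] Xp; have [normE _] := distE p p Xp Xp.
apply/(tnorm_eq0 p)/eqP; rewrite eq_le sqrtr_ge0 andbT -lee_fin normE.
by apply: ereal_inf_lbound; exact: joined_nil.
Qed.

(** Expanding by bilinearity and symmetry leaves a rational identity in the six inner products among
    [g], [P] and [V]. *)
Lemma complete_square p (a c mu b : R) (g P V : 'rV[R]_n) :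
  b = (1 - a) * c + a * mu -> b != 0 ->
  a ^+ 2 / (2 * b) * tnorm p g ^+ 2 + (1 - a) * (c / 2 * tnorm p (P - V) ^+ 2)
    + a * (inner p g P + mu / 2 * tnorm p P ^+ 2)
  = a * (1 - a) * c / b * (mu / 2 * tnorm p V ^+ 2 + inner p g V)
    + b / 2 * tnorm p (P - (((1 - a) * c / b) *: V - (a / b) *: g)) ^+ 2.
Proof.
move=> -> b0; rewrite !sqr_tnorm !innerE.
rewrite (innerC p V P) (innerC p P g) (innerC p V g).
by field.
Qed.

End Inner.

Lemma cvg0_of_sum_pinfty (R : realType) (alpha lambda : nat -> R) :
  (forall k, 0 < alpha k < 1) ->
  \sum_(0 <= i < k) alpha i @[k --> \oo] --> +oo ->
  lambda 0%N = 1 -> (forall k, lambda k.+1 = (1 - alpha k) * lambda k) ->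
  lambda k @[k --> \oo] --> (0 : R).
Proof.
move=> alpha01 sum_oo lambda0 lambdaS.
pose S k := \sum_(0 <= i < k) alpha i.
have S0 k : 0 <= S k by apply: sumr_ge0 => i _; have /andP[/ltW] := alpha01 i.
have lambda_ge0 k : 0 <= lambda k.
  elim: k => [|k IHk]; first by rewrite lambda0.
  by rewrite lambdaS mulr_ge0 // subr_ge0; have /andP[_ /ltW] := alpha01 k.
have lambdaS1 k : lambda k * (1 + S k) <= 1.
  elim: k => [|k]; first by rewrite lambda0 /S big_geq // addr0 mulr1.
  apply: le_trans; rewrite lambdaS /S big_nat_recr //= -/(S k).
  have /andP[a0 _] := alpha01 k.
  (* Cancelling [lambda k] leaves [(1 - a) * (1 + S k + a) <= 1 + S k] with [a = alpha k]; the gap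
     is [a * (S k + a)]. *)
  rewrite mulrAC mulrC ler_wpM2l //; have := S0 k; nra.
apply/cvgr0Pnorm_le => e e0.
(* Once [1 <= S k * e], having [lambda k > e] would contradict [lambdaS1]. *)
move/cvgryPge: sum_oo => /(_ e^-1); apply: filterS => k.
rewrite -/(S k) -div1r ler_pdivrMr // ger0_norm // => eS.
have := lambdaS1 k; have := lambda_ge0 k; nra.
Qed.

Theorem lemma3 (R : realType) (n : nat) (M : riemannian_manifold R n)
  (X : set M) (f : M -> R) (gradf : M -> 'rV[R]_n) (mu L : R) (xs : M)
  (y v : nat -> M) (gamma gbar Phis alpha : nat -> R)
  (Phi : nat -> M -> R) (lambda : nat -> R)
  (hX : uniquely_geodesic X)
  (hf : is_gradient X f gradf)
  (hmu : 0 < mu) (hmuL : mu <= L)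
  (hsmooth : geodesically_smooth X gradf L)
  (hconvex : geodesically_strongly_convex X f gradf mu)
  (hxs : is_minimizer X f xs)
  (hy : forall k, X (y k)) (hv : forall k, X (v k)) (hv0 : v 0%N = y 0%N)
  (hgamma : forall k, 0 < gamma k)
  (hgbar : forall k, gbar k.+1 = (1 - alpha k) * gamma k + alpha k * mu)
  (hvS : forall k,
    let w := ((1 - alpha k) * gamma k / gbar k.+1) *: Log X (y k) (v k)
             - (alpha k / gbar k.+1) *: gradf (y k) in
    [/\ Exp_dom (y k) w, v k.+1 = Exp (y k) w & Log X (y k) (v k.+1) = w])
  (hPhisS : forall k,
    Phis k.+1 =
      (1 - alpha k) * Phis k + alpha k * f (y k)
      - alpha k ^+ 2 / (2 * gbar k.+1) * tnorm (y k) (gradf (y k)) ^+ 2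
      + alpha k * (1 - alpha k) * gamma k / gbar k.+1
        * (mu / 2 * tnorm (y k) (Log X (y k) (v k)) ^+ 2
           + inner (y k) (gradf (y k)) (Log X (y k) (v k))))
  (hdistort : forall k,
    gamma k.+1
      * tnorm (y k.+1) (Log X (y k.+1) xs - Log X (y k.+1) (v k.+1)) ^+ 2
    <= gbar k.+1 * tnorm (y k) (Log X (y k) xs - Log X (y k) (v k.+1)) ^+ 2)
  (halpha : forall k, 0 < alpha k < 1)
  (hsum : \sum_(0 <= i < k) alpha i @[k --> \oo] --> +oo)
  (hPhi0 : forall x, X x ->
    Phi 0%N x = Phis 0%N + gamma 0%N / 2 * tnorm (y 0%N) (Log X (y 0%N) x) ^+ 2)
  (hPhiS : forall k x, X x ->
    Phi k.+1 x = Phis k.+1 + gamma k.+1 / 2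
      * tnorm (y k.+1) (Log X (y k.+1) x - Log X (y k.+1) (v k.+1)) ^+ 2)
  (hlambda0 : lambda 0%N = 1)
  (hlambdaS : forall k, lambda k.+1 = (1 - alpha k) * lambda k) :
  weak_estimate_sequence f xs Phi lambda.
Proof.
(* As [v 0 = y 0], the centre [Log X (y 0) (v 0)] is zero, so [Phi 0] has the same form as its
   successors. *)
have PhiE k : Phi k xs = Phis k
    + gamma k / 2 * tnorm (y k) (Log X (y k) xs - Log X (y k) (v k)) ^+ 2.
  case: k => [|k]; last by rewrite hPhiS //; case: hxs.
  rewrite hPhi0; last by case: hxs.
  by rewrite hv0 (Log_refl X) // subr0.
have contract k : Phi k.+1 xs <= (1 - alpha k) * Phi k xs + alpha k * f xs.
  have /andP[a0 a1] := halpha k.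
  have gbar0 : 0 < gbar k.+1.
    by rewrite hgbar addr_gt0 // mulr_gt0 // subr_gt0.
  have [_ _ LogE] := hvS k.
  have cvx := hconvex (y k) xs (hy k) hxs.1.
  (* With convexity scaled by [alpha k], the bound is a linear combination of it, half of [hdistort]
     and the completed square. *)
  have := ler_wpM2l (ltW a0) cvx.
  have := hdistort k; rewrite LogE !PhiE hPhisS.
  have := @complete_square _ _ _ (y k) _ _ _ _ (gradf (y k)) (Log X (y k) xs)
    (Log X (y k) (v k)) (hgbar k) (lt0r_neq0 gbar0).
  lra.
split; first exact: cvg0_of_sum_pinfty hlambda0 hlambdaS.
elim=> [|k IHk]; first by rewrite hlambda0 subrr mul0r add0r mul1r.
apply: le_trans (contract k) _.
(* The weights of [f xs] add up: [(1 - alpha k) * (1 - lambda k) + alpha k = 1 - lambda k.+1]. *)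
have /andP[_ a1] := halpha k.
have a1' : 0 <= 1 - alpha k by rewrite subr_ge0 ltW.
have := ler_wpM2l a1' IHk; rewrite hlambdaS; lra.
Qed.
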